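(* Let $\mathcal{C}$ be a restriction category and $T$ a symmetric monoidal monad on $\mathcal{C}$. Then $T$ is domain preserving if and only if the Kleisli category $\mathcal{C}_T$ is a domain category.
   Context: Composition is diagrammatic ($f;g$ means first $f$, then $g$); the right unitor is $\rho_X:X\to X\otimes I$. A gs-monoidal category is a symmetric monoidal category with, for each object $X$, a discharger $!_X:X\to I$ and duplicator $\nabla_X:X\to X\otimes X$, compatible with the monoidal structure, with $\nabla_X$ coassociative, cocommutative, and $(X,\nabla_X,!_X)$ a comonoid. A restriction category is a gs-monoidal category in which every arrow $f:X\to Y$ satisfies $f;\nabla_Y=\nabla_X;(f\otimes f)$. A symmetric monoidal monad $(T,\eta,\mu)$ is a monad whose functor is lax symmetric monoidal with structure $c_{X,Y}:TX\otimes TY\to T(X\otimes Y)$ and unit structure $\eta_I$, such that $\eta$ and $\mu$ are monoidal natural transformations. Its Kleisli category $\mathcal{C}_T$ has the objects of $\mathcal{C}$, arrows $X\to Y$ the arrows $X\to TY$ of $\mathcal{C}$, composition $f;^\sharp g=f;T(g);\mu$, and is gs-monoidal with tensor $f\otimes^\sharp g=(f\otimes g);c$ and structural arrows $\nabla_X;\eta_{X\otimes X}$ and $!_X;\eta_I$. For an arrow $f:X\to Y$ of a gs-monoidal category, $\mathrm{dom}(f):=\nabla_X;(\mathrm{id}_X\otimes(f;!_Y));\rho^{-1}_X$; a domain category is a gs-monoidal category with $\mathrm{dom}(f);f=f$ for all $f$. $T$ is domain preserving if for all $X$: $\nabla_{TX};c_{X,X};T(\mathrm{id}_X\otimes !_X)=T(\rho_X)$.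 *)

(* Defs.v *)
Set Implicit Arguments.
Unset Strict Implicit.
Unset Printing Implicit Defensive.

Declare Scope cat_scope.
Delimit Scope cat_scope with cat.
Local Open Scope cat_scope.

(* Composition is diagrammatic: [f ⨾ g] is first [f], then [g].  Parallel
   arrows are compared with Leibniz equality. *)
Record Category : Type := {
  Ob :> Type;
  Hom : Ob -> Ob -> Type;
  idm : forall X, Hom X X;
  comp : forall X Y Z, Hom X Y -> Hom Y Z -> Hom X Z;
  comp_id_l : forall X Y (f : Hom X Y), comp (idm X) f = f;
  comp_id_r : forall X Y (f : Hom X Y), comp f (idm Y) = f;
  comp_assoc : forall X Y Z W (f : Hom X Y) (g : Hom Y Z) (h : Hom Z W),
    comp (comp f g) h = comp f (comp g h)
}.
Arguments Hom {c} X Y.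
Arguments idm {c} X.
Arguments comp {c X Y Z} f g.
Notation "f ⨾ g" := (comp f g) (at level 45, right associativity) : cat_scope.

Record Functor (C D : Category) : Type := {
  fobj :> C -> D;
  fmap : forall X Y : C, Hom X Y -> Hom (fobj X) (fobj Y);
  fmap_id : forall X : C, fmap (idm X) = idm (fobj X);
  fmap_comp : forall (X Y Z : C) (f : Hom X Y) (g : Hom Y Z),
    fmap (f ⨾ g) = fmap f ⨾ fmap g
}.
Arguments fmap {C D} F {X Y} f : rename.

Definition id_functor (C : Category) : Functor C C := {|
  fobj := fun X : C => X;
  fmap := fun (X Y : C) (f : Hom X Y) => f;
  fmap_id := fun X => eq_refl;
  fmap_comp := fun X Y Z f g => eq_refl
|}.

Lemma comp_functor_id (C D E : Category) (F : Functor C D) (G : Functor D E)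
  (X : C) : fmap G (fmap F (idm X)) = idm (G (F X)).
Proof. now rewrite !fmap_id. Qed.

Lemma comp_functor_comp (C D E : Category) (F : Functor C D) (G : Functor D E)
  (X Y Z : C) (f : Hom X Y) (g : Hom Y Z) :
  fmap G (fmap F (f ⨾ g)) = fmap G (fmap F f) ⨾ fmap G (fmap F g).
Proof. now rewrite !fmap_comp. Qed.

Definition comp_functor (C D E : Category) (F : Functor C D) (G : Functor D E) :
  Functor C E := {|
  fobj := fun X : C => G (F X);
  fmap := fun (X Y : C) (f : Hom X Y) => fmap G (fmap F f);
  fmap_id := comp_functor_id F G;
  fmap_comp := comp_functor_comp F G
|}.

Definition is_natural (C D : Category) (F G : Functor C D)
  (t : forall X : C, Hom (F X) (G X)) : Prop :=
  forall (X Y : C) (f : Hom X Y), fmap F f ⨾ t Y = t X ⨾ fmap G f.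

Record Monad (C : Category) : Type := {
  mfunctor :> Functor C C;
  munit : forall X : C, Hom X (mfunctor X);
  mmult : forall X : C, Hom (mfunctor (mfunctor X)) (mfunctor X);
  munit_natural : is_natural (F := id_functor C) (G := mfunctor) munit;
  mmult_natural :
    is_natural (F := comp_functor mfunctor mfunctor) (G := mfunctor) mmult;
  munit_mmult_l : forall X : C, munit (mfunctor X) ⨾ mmult X = idm (mfunctor X);
  munit_mmult_r : forall X : C,
    fmap mfunctor (munit X) ⨾ mmult X = idm (mfunctor X);
  mmult_assoc : forall X : C,
    mmult (mfunctor X) ⨾ mmult X = fmap mfunctor (mmult X) ⨾ mmult X
}.
Arguments munit {C} T X : rename.
Arguments mmult {C} T X : rename.

(* Pitfall: the unitors [lunit] and [runit] point into the tensor, so the usual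
   unitors are [lunit_inv] and [runit_inv]. *)
Record SymMonCategory : Type := {
  smc_cat :> Category;
  unit_ob : smc_cat;
  tensor_ob : smc_cat -> smc_cat -> smc_cat;
  tensor : forall X Y X' Y' : smc_cat,
    Hom X Y -> Hom X' Y' -> Hom (tensor_ob X X') (tensor_ob Y Y');
  assoc : forall X Y Z : smc_cat,
    Hom (tensor_ob (tensor_ob X Y) Z) (tensor_ob X (tensor_ob Y Z));
  assoc_inv : forall X Y Z : smc_cat,
    Hom (tensor_ob X (tensor_ob Y Z)) (tensor_ob (tensor_ob X Y) Z);
  lunit : forall X : smc_cat, Hom X (tensor_ob unit_ob X);
  lunit_inv : forall X : smc_cat, Hom (tensor_ob unit_ob X) X;
  runit : forall X : smc_cat, Hom X (tensor_ob X unit_ob);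
  runit_inv : forall X : smc_cat, Hom (tensor_ob X unit_ob) X;
  swap : forall X Y : smc_cat, Hom (tensor_ob X Y) (tensor_ob Y X);
  tensor_id : forall X Y : smc_cat,
    tensor (idm X) (idm Y) = idm (tensor_ob X Y);
  tensor_comp : forall (X Y Z X' Y' Z' : smc_cat)
    (f : Hom X Y) (g : Hom Y Z) (f' : Hom X' Y') (g' : Hom Y' Z'),
    tensor (f ⨾ g) (f' ⨾ g') = tensor f f' ⨾ tensor g g';
  assoc_natural : forall (X Y Z X' Y' Z' : smc_cat)
    (f : Hom X X') (g : Hom Y Y') (h : Hom Z Z'),
    tensor (tensor f g) h ⨾ assoc X' Y' Z'
    = assoc X Y Z ⨾ tensor f (tensor g h);
  assocK : forall X Y Z : smc_cat, assoc X Y Z ⨾ assoc_inv X Y Z = idm _;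
  assoc_invK : forall X Y Z : smc_cat, assoc_inv X Y Z ⨾ assoc X Y Z = idm _;
  lunit_natural : forall (X Y : smc_cat) (f : Hom X Y),
    f ⨾ lunit Y = lunit X ⨾ tensor (idm unit_ob) f;
  lunitK : forall X : smc_cat, lunit X ⨾ lunit_inv X = idm _;
  lunit_invK : forall X : smc_cat, lunit_inv X ⨾ lunit X = idm _;
  runit_natural : forall (X Y : smc_cat) (f : Hom X Y),
    f ⨾ runit Y = runit X ⨾ tensor f (idm unit_ob);
  runitK : forall X : smc_cat, runit X ⨾ runit_inv X = idm _;
  runit_invK : forall X : smc_cat, runit_inv X ⨾ runit X = idm _;
  swap_natural : forall (X Y X' Y' : smc_cat) (f : Hom X X') (g : Hom Y Y'),
    tensor f g ⨾ swap X' Y' = swap X Y ⨾ tensor g f;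
  swapK : forall X Y : smc_cat, swap X Y ⨾ swap Y X = idm _;
  pentagon : forall X Y Z W : smc_cat,
    assoc (tensor_ob X Y) Z W ⨾ assoc X Y (tensor_ob Z W)
    = tensor (assoc X Y Z) (idm W) ⨾ assoc X (tensor_ob Y Z) W
      ⨾ tensor (idm X) (assoc Y Z W);
  triangle : forall X Y : smc_cat,
    tensor (runit X) (idm Y) ⨾ assoc X unit_ob Y = tensor (idm X) (lunit Y);
  hexagon : forall X Y Z : smc_cat,
    assoc X Y Z ⨾ swap X (tensor_ob Y Z) ⨾ assoc Y Z X
    = tensor (swap X Y) (idm Z) ⨾ assoc Y X Z ⨾ tensor (idm Y) (swap X Z)
}.
Arguments unit_ob {s}.
Arguments tensor_ob {s} X Y.
Arguments tensor {s X Y X' Y'} f g.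
Arguments assoc {s} X Y Z.
Arguments assoc_inv {s} X Y Z.
Arguments lunit {s} X.
Arguments lunit_inv {s} X.
Arguments runit {s} X.
Arguments runit_inv {s} X.
Arguments swap {s} X Y.
Notation "X ⊗ Y" := (tensor_ob X Y) (at level 40, left associativity)
  : cat_scope.
Notation "f ⊗₁ g" := (tensor f g) (at level 40, left associativity)
  : cat_scope.

Lemma tensor_comp_l (C : SymMonCategory) (X Y Z X' Y' : C)
  (f : Hom X Y) (g : Hom Y Z) (h : Hom X' Y') :
  (f ⨾ g) ⊗₁ h = f ⊗₁ h ⨾ g ⊗₁ idm Y'.
Proof. now rewrite <- tensor_comp, comp_id_r. Qed.

Lemma tensor_comp_r (C : SymMonCategory) (X Y X' Y' Z' : C)
  (h : Hom X Y) (f : Hom X' Y') (g : Hom Y' Z') :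
  h ⊗₁ (f ⨾ g) = h ⊗₁ f ⨾ idm Y ⊗₁ g.
Proof. now rewrite <- tensor_comp, comp_id_r. Qed.

Definition middle_swap (C : SymMonCategory) (X Y Z W : C) :
  Hom ((X ⊗ Y) ⊗ (Z ⊗ W)) ((X ⊗ Z) ⊗ (Y ⊗ W)) :=
  assoc X Y (Z ⊗ W)
  ⨾ idm X ⊗₁ (assoc_inv Y Z W ⨾ swap Y Z ⊗₁ idm W ⨾ assoc Z Y W)
  ⨾ assoc_inv X Z (Y ⊗ W).

Record is_lax_symmetric_monoidal (C D : SymMonCategory) (F : Functor C D)
  (e : Hom unit_ob (F unit_ob))
  (c : forall X Y : C, Hom (F X ⊗ F Y) (F (X ⊗ Y))) : Prop := {
  lax_natural : forall (X Y X' Y' : C) (f : Hom X X') (g : Hom Y Y'),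
    fmap F f ⊗₁ fmap F g ⨾ c X' Y' = c X Y ⨾ fmap F (f ⊗₁ g);
  lax_assoc : forall X Y Z : C,
    c X Y ⊗₁ idm (F Z) ⨾ c (X ⊗ Y) Z ⨾ fmap F (assoc X Y Z)
    = assoc (F X) (F Y) (F Z) ⨾ idm (F X) ⊗₁ c Y Z ⨾ c X (Y ⊗ Z);
  lax_lunit : forall X : C,
    lunit (F X) ⨾ e ⊗₁ idm (F X) ⨾ c unit_ob X = fmap F (lunit X);
  lax_runit : forall X : C,
    runit (F X) ⨾ idm (F X) ⊗₁ e ⨾ c X unit_ob = fmap F (runit X);
  lax_swap : forall X Y : C,
    c X Y ⨾ fmap F (swap X Y) = swap (F X) (F Y) ⨾ c Y X
}.

Record is_monoidal_transformation (C D : SymMonCategory) (F G : Functor C D)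
  (eF : Hom unit_ob (F unit_ob))
  (cF : forall X Y : C, Hom (F X ⊗ F Y) (F (X ⊗ Y)))
  (eG : Hom unit_ob (G unit_ob))
  (cG : forall X Y : C, Hom (G X ⊗ G Y) (G (X ⊗ Y)))
  (t : forall X : C, Hom (F X) (G X)) : Prop := {
  montrans_natural : is_natural t;
  montrans_unit : eF ⨾ t unit_ob = eG;
  montrans_tensor : forall X Y : C, cF X Y ⨾ t (X ⊗ Y) = t X ⊗₁ t Y ⨾ cG X Y
}.

Record SymMonMonad (C : SymMonCategory) : Type := {
  smm_monad :> Monad C;
  mtensor : forall X Y : C,
    Hom (smm_monad X ⊗ smm_monad Y) (smm_monad (X ⊗ Y));
  smm_lax : is_lax_symmetric_monoidal (F := smm_monad)
    (munit smm_monad unit_ob) mtensor;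
  munit_monoidal : is_monoidal_transformation
    (F := id_functor C) (G := smm_monad)
    (idm unit_ob) (fun X Y => idm (X ⊗ Y))
    (munit smm_monad unit_ob) mtensor
    (munit smm_monad);
  mmult_monoidal : is_monoidal_transformation
    (F := comp_functor smm_monad smm_monad) (G := smm_monad)
    (munit smm_monad unit_ob ⨾ fmap smm_monad (munit smm_monad unit_ob))
    (fun X Y => mtensor (smm_monad X) (smm_monad Y)
                ⨾ fmap smm_monad (mtensor X Y))
    (munit smm_monad unit_ob) mtensor
    (mmult smm_monad)
}.
Arguments mtensor {C} T X Y : rename.

Record GSMonCategory : Type := {
  gs_smc :> SymMonCategory;
  discharge : forall X : gs_smc, Hom X unit_ob;
  duplicate : forall X : gs_smc, Hom X (X ⊗ X);
  duplicate_coassoc : forall X : gs_smc,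
    duplicate X ⨾ duplicate X ⊗₁ idm X ⨾ assoc X X X
    = duplicate X ⨾ idm X ⊗₁ duplicate X;
  duplicate_counit_l : forall X : gs_smc,
    duplicate X ⨾ discharge X ⊗₁ idm X = lunit X;
  duplicate_counit_r : forall X : gs_smc,
    duplicate X ⨾ idm X ⊗₁ discharge X = runit X;
  duplicate_cocomm : forall X : gs_smc, duplicate X ⨾ swap X X = duplicate X;
  discharge_unit : discharge unit_ob = idm unit_ob;
  duplicate_unit : duplicate unit_ob = runit unit_ob;
  discharge_tensor : forall X Y : gs_smc,
    discharge (X ⊗ Y) = discharge X ⊗₁ discharge Y ⨾ runit_inv unit_ob;
  duplicate_tensor : forall X Y : gs_smc,
    duplicate (X ⊗ Y) = duplicate X ⊗₁ duplicate Y ⨾ middle_swap X X Y Y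
}.
Arguments discharge {g} X.
Arguments duplicate {g} X.

Definition is_restriction_category (C : GSMonCategory) : Prop :=
  forall (X Y : C) (f : Hom X Y), f ⨾ duplicate Y = duplicate X ⨾ f ⊗₁ f.

Definition dom (C : GSMonCategory) (X Y : C) (f : Hom X Y) : Hom X X :=
  duplicate X ⨾ idm X ⊗₁ (f ⨾ discharge Y) ⨾ runit_inv X.

Definition is_domain_category (C : GSMonCategory) : Prop :=
  forall (X Y : C) (f : Hom X Y), dom f ⨾ f = f.

Definition domain_preserving (C : GSMonCategory) (T : SymMonMonad C) : Prop :=
  forall X : C,
    duplicate (T X) ⨾ mtensor T X X ⨾ fmap T (idm X ⊗₁ discharge X)
    = fmap T (runit X).

Definition kl_comp (C : Category) (T : Monad C) (X Y Z : C)
  (f : Hom X (T Y)) (g : Hom Y (T Z)) : Hom X (T Z) :=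
  f ⨾ fmap T g ⨾ mmult T Z.

Definition kl_tensor (C : SymMonCategory) (T : SymMonMonad C)
  (X Y X' Y' : C) (f : Hom X (T Y)) (g : Hom X' (T Y')) :
  Hom (X ⊗ X') (T (Y ⊗ Y')) :=
  f ⊗₁ g ⨾ mtensor T Y Y'.

Definition kl_pure (C : Category) (T : Monad C) (X Y : C) (f : Hom X Y) :
  Hom X (T Y) := f ⨾ munit T Y.
Arguments kl_pure {C} T {X Y} f.

Section KleisliCategory.
Context (C : Category) (T : Monad C).

Lemma kl_pureE (X Y Z : C) (f : Hom X Y) (g : Hom Y (T Z)) :
  kl_comp (kl_pure T f) g = f ⨾ g.
Proof.
unfold kl_comp, kl_pure.
pose proof (munit_natural T g) as n; simpl in n.
rewrite comp_assoc, <- (comp_assoc (munit T Y)), <- n.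
now rewrite comp_assoc, munit_mmult_l, comp_id_r.
Qed.

Lemma kl_comp_pure (X Y Z : C) (f : Hom X (T Y)) (g : Hom Y Z) :
  kl_comp f (kl_pure T g) = f ⨾ fmap T g.
Proof.
unfold kl_comp, kl_pure.
now rewrite fmap_comp, comp_assoc, munit_mmult_r, comp_id_r.
Qed.

Lemma kl_pure_comp (X Y Z : C) (f : Hom X Y) (g : Hom Y Z) :
  kl_comp (kl_pure T f) (kl_pure T g) = kl_pure T (f ⨾ g).
Proof. rewrite kl_pureE; unfold kl_pure; now rewrite comp_assoc. Qed.

Lemma kl_pure_id (X : C) : munit T X = kl_pure T (idm X).
Proof. unfold kl_pure; now rewrite comp_id_l. Qed.

Lemma kl_comp_id_l (X Y : C) (f : Hom X (T Y)) : kl_comp (munit T X) f = f.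
Proof. now rewrite kl_pure_id, kl_pureE, comp_id_l. Qed.

Lemma kl_comp_id_r (X Y : C) (f : Hom X (T Y)) : kl_comp f (munit T Y) = f.
Proof. now rewrite kl_pure_id, kl_comp_pure, fmap_id, comp_id_r. Qed.

Lemma kl_comp_assoc (X Y Z W : C)
  (f : Hom X (T Y)) (g : Hom Y (T Z)) (h : Hom Z (T W)) :
  kl_comp (kl_comp f g) h = kl_comp f (kl_comp g h).
Proof.
unfold kl_comp.
pose proof (mmult_natural T h) as n; simpl in n.
rewrite !fmap_comp, !comp_assoc, <- mmult_assoc.
now rewrite <- (comp_assoc (mmult T Z)), <- n, comp_assoc.
Qed.

Definition kleisli_category : Category := {|
  Ob := Ob C;
  Hom := fun X Y : C => Hom X (T Y);
  idm := munit T;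
  comp := @kl_comp C T;
  comp_id_l := kl_comp_id_l;
  comp_id_r := kl_comp_id_r;
  comp_assoc := kl_comp_assoc
|}.

End KleisliCategory.

Section KleisliSymMonCategory.
Context (C : SymMonCategory) (T : SymMonMonad C).

Lemma kl_tensor_pure (X Y X' Y' : C) (f : Hom X Y) (g : Hom X' Y') :
  kl_tensor (kl_pure T f) (kl_pure T g) = kl_pure T (f ⊗₁ g).
Proof.
unfold kl_tensor, kl_pure.
rewrite tensor_comp, comp_assoc.
pose proof (montrans_tensor (munit_monoidal T) Y Y') as e; simpl in e.
now rewrite <- e, comp_id_l.
Qed.

Lemma kl_tensor_id (X Y : C) :
  kl_tensor (munit T X) (munit T Y) = munit T (X ⊗ Y).
Proof. now rewrite !kl_pure_id, kl_tensor_pure, tensor_id. Qed.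

Lemma kl_tensor_comp (X Y Z X' Y' Z' : C)
  (f : Hom X (T Y)) (g : Hom Y (T Z)) (f' : Hom X' (T Y')) (g' : Hom Y' (T Z')) :
  kl_tensor (kl_comp f g) (kl_comp f' g')
  = kl_comp (kl_tensor f f') (kl_tensor g g').
Proof.
unfold kl_tensor, kl_comp.
pose proof (montrans_tensor (mmult_monoidal T) Z Z') as e; simpl in e.
rewrite !tensor_comp, !comp_assoc, <- e, fmap_comp, !comp_assoc.
rewrite <- (comp_assoc (fmap T g ⊗₁ fmap T g')).
now rewrite (lax_natural (smm_lax T)), comp_assoc.
Qed.

Lemma kl_assoc_natural (X Y Z X' Y' Z' : C)
  (f : Hom X (T X')) (g : Hom Y (T Y')) (h : Hom Z (T Z')) :
  kl_comp (kl_tensor (kl_tensor f g) h) (kl_pure T (assoc X' Y' Z'))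
  = kl_comp (kl_pure T (assoc X Y Z)) (kl_tensor f (kl_tensor g h)).
Proof.
rewrite kl_comp_pure, kl_pureE; unfold kl_tensor.
rewrite tensor_comp_l, tensor_comp_r, !comp_assoc, (lax_assoc (smm_lax T)).
now rewrite <- (comp_assoc (f ⊗₁ g ⊗₁ h)), assoc_natural, !comp_assoc.
Qed.

Lemma kl_lunit_natural (X Y : C) (f : Hom X (T Y)) :
  kl_comp f (kl_pure T (lunit Y))
  = kl_comp (kl_pure T (lunit X)) (kl_tensor (munit T unit_ob) f).
Proof.
rewrite kl_comp_pure, kl_pureE; unfold kl_tensor.
rewrite <- (lax_lunit (smm_lax T)), <- comp_assoc, lunit_natural.
rewrite comp_assoc, <- (comp_assoc (idm _ ⊗₁ f)), <- tensor_comp.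
now rewrite comp_id_l, comp_id_r.
Qed.

Lemma kl_runit_natural (X Y : C) (f : Hom X (T Y)) :
  kl_comp f (kl_pure T (runit Y))
  = kl_comp (kl_pure T (runit X)) (kl_tensor f (munit T unit_ob)).
Proof.
rewrite kl_comp_pure, kl_pureE; unfold kl_tensor.
rewrite <- (lax_runit (smm_lax T)), <- comp_assoc, runit_natural.
rewrite comp_assoc, <- (comp_assoc (f ⊗₁ idm _)), <- tensor_comp.
now rewrite comp_id_l, comp_id_r.
Qed.

Lemma kl_swap_natural (X Y X' Y' : C) (f : Hom X (T X')) (g : Hom Y (T Y')) :
  kl_comp (kl_tensor f g) (kl_pure T (swap X' Y'))
  = kl_comp (kl_pure T (swap X Y)) (kl_tensor g f).
Proof.
rewrite kl_comp_pure, kl_pureE; unfold kl_tensor.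
now rewrite comp_assoc, (lax_swap (smm_lax T)), <- !comp_assoc, swap_natural.
Qed.

Local Notation "f ⨾^ g" := (kl_comp f g) (at level 45, right associativity).
Local Notation "f ⊗^ g" := (kl_tensor f g) (at level 40, left associativity).

Lemma kl_assocK (X Y Z : C) :
  kl_pure T (assoc X Y Z) ⨾^ kl_pure T (assoc_inv X Y Z)
  = munit T ((X ⊗ Y) ⊗ Z).
Proof. now rewrite kl_pure_comp, assocK, <- kl_pure_id. Qed.

Lemma kl_assoc_invK (X Y Z : C) :
  kl_pure T (assoc_inv X Y Z) ⨾^ kl_pure T (assoc X Y Z)
  = munit T (X ⊗ (Y ⊗ Z)).
Proof. now rewrite kl_pure_comp, assoc_invK, <- kl_pure_id. Qed.

Lemma kl_lunitK (X : C) :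
  kl_pure T (lunit X) ⨾^ kl_pure T (lunit_inv X) = munit T X.
Proof. now rewrite kl_pure_comp, lunitK, <- kl_pure_id. Qed.

Lemma kl_lunit_invK (X : C) :
  kl_pure T (lunit_inv X) ⨾^ kl_pure T (lunit X) = munit T (unit_ob ⊗ X).
Proof. now rewrite kl_pure_comp, lunit_invK, <- kl_pure_id. Qed.

Lemma kl_runitK (X : C) :
  kl_pure T (runit X) ⨾^ kl_pure T (runit_inv X) = munit T X.
Proof. now rewrite kl_pure_comp, runitK, <- kl_pure_id. Qed.

Lemma kl_runit_invK (X : C) :
  kl_pure T (runit_inv X) ⨾^ kl_pure T (runit X) = munit T (X ⊗ unit_ob).
Proof. now rewrite kl_pure_comp, runit_invK, <- kl_pure_id. Qed.

Lemma kl_swapK (X Y : C) :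
  kl_pure T (swap X Y) ⨾^ kl_pure T (swap Y X) = munit T (X ⊗ Y).
Proof. now rewrite kl_pure_comp, swapK, <- kl_pure_id. Qed.

Lemma kl_pentagon (X Y Z W : C) :
  kl_pure T (assoc (X ⊗ Y) Z W) ⨾^ kl_pure T (assoc X Y (Z ⊗ W))
  = kl_pure T (assoc X Y Z) ⊗^ munit T W
    ⨾^ kl_pure T (assoc X (Y ⊗ Z) W)
    ⨾^ munit T X ⊗^ kl_pure T (assoc Y Z W).
Proof.
now rewrite !kl_pure_id, !kl_tensor_pure, !kl_pure_comp, pentagon.
Qed.

Lemma kl_triangle (X Y : C) :
  kl_pure T (runit X) ⊗^ munit T Y ⨾^ kl_pure T (assoc X unit_ob Y)
  = munit T X ⊗^ kl_pure T (lunit Y).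
Proof.
now rewrite !kl_pure_id, !kl_tensor_pure, !kl_pure_comp, triangle.
Qed.

Lemma kl_hexagon (X Y Z : C) :
  kl_pure T (assoc X Y Z) ⨾^ kl_pure T (swap X (Y ⊗ Z))
    ⨾^ kl_pure T (assoc Y Z X)
  = kl_pure T (swap X Y) ⊗^ munit T Z
    ⨾^ kl_pure T (assoc Y X Z)
    ⨾^ munit T Y ⊗^ kl_pure T (swap X Z).
Proof.
now rewrite !kl_pure_id, !kl_tensor_pure, !kl_pure_comp, hexagon.
Qed.

Definition kleisli_symmon : SymMonCategory := {|
  smc_cat := kleisli_category T;
  unit_ob := unit_ob : C;
  tensor_ob := fun X Y : C => X ⊗ Y;
  tensor := @kl_tensor C T;
  assoc := fun X Y Z : C => kl_pure T (assoc X Y Z);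
  assoc_inv := fun X Y Z : C => kl_pure T (assoc_inv X Y Z);
  lunit := fun X : C => kl_pure T (lunit X);
  lunit_inv := fun X : C => kl_pure T (lunit_inv X);
  runit := fun X : C => kl_pure T (runit X);
  runit_inv := fun X : C => kl_pure T (runit_inv X);
  swap := fun X Y : C => kl_pure T (swap X Y);
  tensor_id := kl_tensor_id;
  tensor_comp := kl_tensor_comp;
  assoc_natural := kl_assoc_natural;
  assocK := kl_assocK;
  assoc_invK := kl_assoc_invK;
  lunit_natural := kl_lunit_natural;
  lunitK := kl_lunitK;
  lunit_invK := kl_lunit_invK;
  runit_natural := kl_runit_natural;
  runitK := kl_runitK;
  runit_invK := kl_runit_invK;
  swap_natural := kl_swap_natural;
  swapK := kl_swapK;
  pentagon := kl_pentagon;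
  triangle := kl_triangle;
  hexagon := kl_hexagon
|}.

End KleisliSymMonCategory.

Section KleisliGSMonCategory.
Context (C : GSMonCategory) (T : SymMonMonad C).
Local Notation "f ⨾^ g" := (kl_comp f g) (at level 45, right associativity).
Local Notation "f ⊗^ g" := (kl_tensor f g) (at level 40, left associativity).

Lemma kl_duplicate_coassoc (X : C) :
  kl_pure T (duplicate X) ⨾^ kl_pure T (duplicate X) ⊗^ munit T X
    ⨾^ kl_pure T (assoc X X X)
  = kl_pure T (duplicate X) ⨾^ munit T X ⊗^ kl_pure T (duplicate X).
Proof.
now rewrite !kl_pure_id, !kl_tensor_pure, !kl_pure_comp, duplicate_coassoc.
Qed.

Lemma kl_duplicate_counit_l (X : C) :
  kl_pure T (duplicate X) ⨾^ kl_pure T (discharge X) ⊗^ munit T X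
  = kl_pure T (lunit X).
Proof.
now rewrite kl_pure_id, kl_tensor_pure, kl_pure_comp, duplicate_counit_l.
Qed.

Lemma kl_duplicate_counit_r (X : C) :
  kl_pure T (duplicate X) ⨾^ munit T X ⊗^ kl_pure T (discharge X)
  = kl_pure T (runit X).
Proof.
now rewrite kl_pure_id, kl_tensor_pure, kl_pure_comp, duplicate_counit_r.
Qed.

Lemma kl_duplicate_cocomm (X : C) :
  kl_pure T (duplicate X) ⨾^ kl_pure T (swap X X) = kl_pure T (duplicate X).
Proof. now rewrite kl_pure_comp, duplicate_cocomm. Qed.

Lemma kl_discharge_unit :
  kl_pure T (discharge (unit_ob : C)) = munit T (unit_ob : C).
Proof. now rewrite discharge_unit, <- kl_pure_id. Qed.

Lemma kl_duplicate_unit :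
  kl_pure T (duplicate (unit_ob : C)) = kl_pure T (runit (unit_ob : C)).
Proof. now rewrite duplicate_unit. Qed.

Lemma kl_discharge_tensor (X Y : C) :
  kl_pure T (discharge (X ⊗ Y))
  = kl_pure T (discharge X) ⊗^ kl_pure T (discharge Y)
    ⨾^ kl_pure T (runit_inv unit_ob).
Proof. now rewrite kl_tensor_pure, kl_pure_comp, discharge_tensor. Qed.

Lemma kl_middle_swap (X Y Z W : C) :
  @middle_swap (kleisli_symmon T) X Y Z W = kl_pure T (middle_swap X Y Z W).
Proof.
change (kl_pure T (assoc X Y (Z ⊗ W))
  ⨾^ munit T X ⊗^ (kl_pure T (assoc_inv Y Z W)
       ⨾^ kl_pure T (swap Y Z) ⊗^ munit T W ⨾^ kl_pure T (assoc Z Y W))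
  ⨾^ kl_pure T (assoc_inv X Z (Y ⊗ W)) = kl_pure T (middle_swap X Y Z W)).
rewrite !kl_pure_id, kl_tensor_pure, !kl_pure_comp, kl_tensor_pure.
now rewrite !kl_pure_comp.
Qed.

Lemma kl_duplicate_tensor (X Y : C) :
  kl_pure T (duplicate (X ⊗ Y))
  = kl_pure T (duplicate X) ⊗^ kl_pure T (duplicate Y)
    ⨾^ @middle_swap (kleisli_symmon T) X X Y Y.
Proof.
now rewrite kl_middle_swap, kl_tensor_pure, kl_pure_comp, duplicate_tensor.
Qed.

Definition kleisli : GSMonCategory := {|
  gs_smc := kleisli_symmon T;
  discharge := fun X : C => kl_pure T (discharge X);
  duplicate := fun X : C => kl_pure T (duplicate X);
  duplicate_coassoc := kl_duplicate_coassoc;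
  duplicate_counit_l := kl_duplicate_counit_l;
  duplicate_counit_r := kl_duplicate_counit_r;
  duplicate_cocomm := kl_duplicate_cocomm;
  discharge_unit := kl_discharge_unit;
  duplicate_unit := kl_duplicate_unit;
  discharge_tensor := kl_discharge_tensor;
  duplicate_tensor := kl_duplicate_tensor
|}.

End KleisliGSMonCategory.

(* Main.v *)
(* In any gs-monoidal category [dom f ; f = ∇ ; (f ⊗ f) ; (id ⊗ !) ; ρ⁻¹].  Read
   in the Kleisli category, with [f ; ∇ = ∇ ; (f ⊗ f)] in the base, this is
   [f ; (∇ ; c ; T(id ⊗ !)) ; T(ρ⁻¹)].  Domain preservation says that what follows
   [f] is the identity; conversely, take [f] to be the identity of [T X], seen as
   a Kleisli arrow from [T X] to [X]. *)
Require Import Defs.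

Set Implicit Arguments.
Unset Strict Implicit.
Local Open Scope cat_scope.

Lemma runit_inv_natural (C : SymMonCategory) (X Y : C) (f : Hom X Y) :
  runit_inv X ⨾ f = f ⊗₁ idm unit_ob ⨾ runit_inv Y.
Proof.
rewrite <- (comp_id_r (runit_inv X ⨾ f)), <- (runitK Y), comp_assoc.
rewrite <- (comp_assoc f), runit_natural, comp_assoc.
now rewrite <- comp_assoc, runit_invK, comp_id_l.
Qed.

(** Naturality of [ρ⁻¹] slides the trailing [f] into the left tensor factor. *)
Lemma dom_comp_self (C : GSMonCategory) (X Y : C) (f : Hom X Y) :
  dom f ⨾ f
  = duplicate X ⨾ f ⊗₁ f ⨾ idm Y ⊗₁ discharge Y ⨾ runit_inv Y.
Proof.
unfold dom.
rewrite !comp_assoc, runit_inv_natural, <- !(comp_assoc (_ ⊗₁ _)).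
now rewrite <- !tensor_comp, comp_id_l, !comp_id_r.
Qed.

Lemma kleisli_dom_comp_self (C : GSMonCategory) (T : SymMonMonad C)
  (hC : is_restriction_category C) (X Y : C) (f : Hom X (T Y)) :
  kl_comp (@dom (kleisli T) X Y f) f
  = f ⨾ (duplicate (T Y) ⨾ mtensor T Y Y ⨾ fmap T (idm Y ⊗₁ discharge Y))
      ⨾ fmap T (runit_inv Y).
Proof.
(* [dom_comp_self] in [kleisli T], restated by conversion so that the [kl_pure] lemmas can rewrite
   it. *)
transitivity (kl_comp (kl_pure T (duplicate X))
  (kl_comp (kl_tensor f f)
    (kl_comp (kl_tensor (munit T Y) (kl_pure T (discharge Y)))
      (kl_pure T (runit_inv Y))))).
{ exact (@dom_comp_self (kleisli T) X Y f). }
rewrite kl_pure_id, kl_tensor_pure, kl_pure_comp, kl_comp_pure, kl_pureE.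
unfold kl_tensor.
(* [hC] applies to [f] as a base arrow into [T Y], so the duplicator becomes that of [T Y]. *)
rewrite fmap_comp, !comp_assoc, <- (comp_assoc (duplicate X)), <- hC.
now rewrite comp_assoc.
Qed.

Theorem theorem5p2 (C : GSMonCategory) (hC : is_restriction_category C)
  (T : SymMonMonad C) :
  domain_preserving T <-> is_domain_category (kleisli T).
Proof.
split.
- intros hT X Y f.
  etransitivity; [exact (kleisli_dom_comp_self hC f) |].
  now rewrite hT, <- fmap_comp, runitK, fmap_id, comp_id_r.
- intros hK X.
  pose proof (eq_trans (eq_sym (kleisli_dom_comp_self hC (idm (T X))))
                (hK (T X : C) X (idm (T X)))) as e.
  rewrite comp_id_l in e.
  (* Insert [e] as the identity before [T(ρ)]; then [T(ρ⁻¹)] and [T(ρ)] cancel. *)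
  rewrite <- (comp_id_l (fmap T (runit X))), <- e, comp_assoc, <- fmap_comp.
  now rewrite runit_invK, fmap_id, comp_id_r.
Qed.
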